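(* Let $\mathcal{K}\subseteq\mathbb{Z}_N$ be an $(N,K,\lambda)$ difference set, let $v=\frac{1}{\sqrt{K}}\chi_{\mathcal{K}}\in\mathbb{C}^N$, and for $i=0,\dots,N-1$ let $\mathcal{W}_i=\operatorname{span}\{M_jT_iv\}_{j=0}^{N-1}\subseteq\mathbb{C}^N$. Then the family of subspaces $\{\mathcal{W}_i\}_{i=0}^{N-1}$ is a $K$-tight fusion frame for $\mathbb{C}^N$.
   Context: $\mathbb{Z}_N=\{0,1,\dots,N-1\}$ with arithmetic modulo $N$; vectors in $\mathbb{C}^N$ are indexed by $\mathbb{Z}_N$, and all index operations are modulo $N$. Difference set: a nonempty subset $\mathcal{K}=\{u_1,\dots,u_K\}\subseteq\mathbb{Z}_N$ with $K$ elements is an $(N,K,\lambda)$ difference set if the $K(K-1)$ differences $(u_k-u_l)\bmod N$, $k\ne l$, take all nonzero values $1,2,\dots,N-1$, each exactly $\lambda$ times. $\chi_{\mathcal{K}}\in\mathbb{C}^N$ is the characteristic function of $\mathcal{K}$: $\chi_{\mathcal{K}}(j)=1$ if $j\in\mathcal{K}$ and $0$ otherwise. Modulation and translation operators on $\mathbb{C}^N$: $(M_jg)(n)=e^{2\pi i jn/N}g(n)$ and $(T_kg)(n)=g(n-k)$ for $n=0,\dots,N-1$. The subspace $\mathcal{W}_i$ is also described as the space of all $x\in\mathbb{C}^N$ with $\operatorname{supp}(x)\subseteq\mathcal{K}+i$. A family of subspaces $\{\mathcal{W}_i\}$ of $\mathbb{C}^N$ is an $A$-tight fusion frame (all weights equal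 to one), $A>0$, if $\sum_i\|P_i x\|_2^2=A\|x\|_2^2$ for all $x\in\mathbb{C}^N$, where $P_i$ is the orthogonal projection of $\mathbb{C}^N$ onto $\mathcal{W}_i$. *)

(* Defs.v *)
From HB Require Import structures.
From mathcomp Require Import all_boot all_order all_algebra.
From mathcomp Require Import spectral reals trigo complex.

Set Implicit Arguments.
Unset Strict Implicit.
Unset Printing Implicit Defensive.

Import Order.TTheory GRing.Theory Num.Theory.
Local Open Scope ring_scope.
Local Open Scope complex_scope.

(* The cyclic group Z_N is 'I_n.+1 with N = n.+1, whose canonical additive    *)
(* structure is addition modulo N ('Z_N would be wrong for N = 1).            *)
(* C^N is the space 'rV[R[i]]_N of row vectors, R being the real numbers.     *)

(* The ordered pairs (a, b) of distinct elements of D enumerate the           *)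
(* differences a - b with multiplicity.                                       *)
Definition difference_set (n : nat) (D : {set 'I_n.+1}) (k lambda : nat) :=
  [/\ D != set0, #|D| = k &
    forall d : 'I_n.+1, d != 0 ->
      #|[set p : 'I_n.+1 * 'I_n.+1 |
          [&& p.1 \in D, p.2 \in D, p.1 != p.2 & p.1 - p.2 == d]]| = lambda].

(* e^(i t) *)
Definition cis (R : realType) (t : R) : R[i] := cos t +i* sin t.

Definition modulation (R : realType) (n : nat) (j : 'I_n.+1)
    (g : 'rV[R[i]]_n.+1) : 'rV[R[i]]_n.+1 :=
  \row_m (cis (2%:R * pi * (j : nat)%:R * (m : nat)%:R / n.+1%:R) * g 0 m).

Definition translation (R : realType) (n : nat) (k : 'I_n.+1)
    (g : 'rV[R[i]]_n.+1) : 'rV[R[i]]_n.+1 :=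
  \row_m g 0 (m - k).

Definition char_vec (R : realType) (n : nat) (D : {set 'I_n.+1}) :
    'rV[R[i]]_n.+1 :=
  \row_m (if m \in D then 1 else 0).

(* As in mxalgebra, a subspace of C^N is the row space of a matrix; the j-th  *)
(* row of this one is M_j T_i g, so its row space is the span of these        *)
(* vectors.                                                                   *)
Definition gabor_space (R : realType) (n : nat) (g : 'rV[R[i]]_n.+1)
    (i : 'I_n.+1) : 'M[R[i]]_n.+1 :=
  \matrix_(j < n.+1) modulation j (translation i g).

(* Squared l2-norm *)
Definition sqnorm2 (R : realType) (N : nat) (x : 'rV[R[i]]_N) : R[i] :=
  \sum_(j < N) `|x 0 j| ^+ 2.

(* proj_ortho U acts on row vectors from the right; it is the orthogonal      *)
(* projection onto the row space of U for the standard Hermitian product.     *)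
Definition tight_fusion_frame (R : realType) (I : finType) (m N : nat)
    (W : I -> 'M[R[i]]_(m, N)) (A : R) :=
  0 < A /\
  forall x : 'rV[R[i]]_N,
    \sum_(i : I) sqnorm2 (x *m proj_ortho (W i)) = A%:C * sqnorm2 x.

(* Main.v *)
Require Import Defs.
From mathcomp Require Import all_boot all_order all_algebra.
From mathcomp Require Import reals complex.
From mathcomp Require Import sesquilinear spectral trigo ring lra.
Import Order.TTheory GRing.Theory Num.Theory.
Local Open Scope ring_scope.
Local Open Scope complex_scope.

(** The vectors [M_j T_i v] are, for fixed [i], the rows of the Fourier matrix
    with its [m]-th column multiplied by [v (m - i)].  The Fourier matrix
    is a Vandermonde matrix with pairwise distinct nodes, hence invertible
    ([fourier_unitmx]), so these vectors span exactly the space of all vectors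
    supported on the translated support [supp v + i], and the orthogonal
    projection onto it erases the coordinates outside that set
    ([proj_ortho_gabor_space]).  Thus [|x(m)|^2] contributes to
    [sum_i |P_i x|^2] once for each [i] with [m - i] in [supp v], that is,
    [#|supp v|] times, whatever [m] is ([sum_sqnorm2_gabor_space]).  For the
    window of the theorem this support is the difference set, of size [K]. *)

Lemma cisX (R : realType) (t : R) (k : nat) : cis t ^+ k = cis (t *+ k).
Proof.
elim: k => [|k IH]; first by rewrite expr0 mulr0n /cis cos0 sin0.
by rewrite exprS IH mulrS /cis cosD sinD; simpc; congr (_ +i* _); exact: addrC.
Qed.

(** If [cis s = cis t] then [cos (t - s) = 1], so [sin ((t - s) / 2) = 0] by
    the half-angle formula; but sine is positive on the open interval from 0
    to pi, where the bounds on [s] and [t] place [(t - s) / 2]. *)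
Lemma cis_lt_neq (R : realType) (s t : R) :
  0 <= s -> s < t -> t < pi *+ 2 -> cis s <> cis t.
Proof.
move=> s_ge0 lt_st t_lt [eq_cos eq_sin].
have cos1 : cos (t - s) = 1.
  by rewrite cosB eq_cos eq_sin -!expr2 cos2Dsin2.
have := cos_mulr2n ((t - s) / 2).
have -> : (t - s) / 2 *+ 2 = t - s by lra.
rewrite cos1.
have : 0 < sin ((t - s) / 2) by apply: sin_gt0_pi; apply/andP; split; lra.
rewrite cos2sin2; nra.
Qed.

Definition unity_root (R : realType) {n : nat} (m : 'I_n.+1) : R[i] :=
  cis ((pi *+ 2) * (m : nat)%:R / n.+1%:R).

Lemma unity_root_inj (R : realType) (n : nat) : injective (@unity_root R n).
Proof.
have neq (a b : 'I_n.+1) : (a < b)%N -> unity_root R a <> unity_root R b.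
  move=> lt_ab; have pi2_gt0 : 0 < pi *+ 2 :> R by rewrite pmulrn_lgt0 // pi_gt0.
  have N_gt0 : 0 < n.+1%:R :> R by rewrite ltr0n.
  apply: cis_lt_neq.
  - by rewrite divr_ge0 ?mulr_ge0 // ltW.
  - by rewrite ltr_pM2r ?invr_gt0 // ltr_pM2l // ltr_nat.
  - by rewrite ltr_pdivrMr // ltr_pM2l // ltr_nat ltn_ord.
move=> a b eq_ab; apply/val_inj; case: (ltngtP a b) => // lt_ab.
  by case: (neq _ _ lt_ab).
by case: (neq _ _ lt_ab).
Qed.

Definition fourier (R : realType) (n : nat) : 'M[R[i]]_n.+1 :=
  Vandermonde n.+1 (\row_m unity_root R m).

Lemma fourier_unitmx (R : realType) (n : nat) : fourier R n \in unitmx.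
Proof.
rewrite unitmxE unitfE det_Vandermonde; apply/prodf_neq0 => a _.
apply/prodf_neq0 => b lt_ab; rewrite !mxE subr_eq0 (inj_eq (unity_root_inj R n)).
by rewrite neq_ltn lt_ab orbT.
Qed.

Lemma gabor_spaceE (R : realType) (n : nat) (g : 'rV[R[i]]_n.+1) (i : 'I_n.+1) :
  gabor_space g i = fourier R n *m diag_mx (translation i g).
Proof.
apply/matrixP => j m; rewrite mul_mx_diag !mxE /unity_root cisX -mulr_natr.
by congr (cis _ * _); rewrite -mulr_natr; ring.
Qed.

Lemma proj_ortho_unique {C : numClosedFieldType} {p m n : nat}
    {U : 'M[C]_(p, n)} {x y : 'M[C]_(m, n)} :
  (y <= U)%MS -> (x - y) *m (U ^t Num.conj)%sesqui = 0 ->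
  x *m proj_ortho U = y.
Proof.
move=> yU /orthomx1P xyU.
by rewrite -[x in LHS](subrK y) mulmxDl proj_ortho_0 // proj_ortho_id // add0r.
Qed.

(** Where [translation i g] vanishes, all vectors of the space vanish, which
    gives the orthogonality; where it does not, dividing by it and inverting
    the Fourier matrix recovers any vector with that support. *)
Lemma proj_ortho_gabor_space (R : realType) (n : nat) (g : 'rV[R[i]]_n.+1)
    (i : 'I_n.+1) (x : 'rV[R[i]]_n.+1) :
  x *m proj_ortho (gabor_space g i) =
  \row_m (if g 0 (m - i) != 0 then x 0 m else 0).
Proof.
apply: proj_ortho_unique.
  (* Where the window vanishes the quotient gets multiplied by 0 again, so its
     value there is irrelevant. *)
  set c := \row_m (x 0 m / g 0 (m - i)).
  apply/submxP; exists (c *m invmx (fourier R n)).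
  rewrite gabor_spaceE mulmxA mulmxKV ?fourier_unitmx //.
  apply/rowP => m; rewrite mul_mx_diag !mxE.
  by case: eqP => [->|/eqP g0]; rewrite ?mulr0 // divfK.
apply/rowP => j; rewrite !mxE big1 // => m _; rewrite !mxE.
by case: eqP => [->|_] /=; rewrite ?mulr0 ?rmorph0 ?mulr0 // subrr mul0r.
Qed.

Lemma sum_sqnorm2_gabor_space (R : realType) (n : nat) (g : 'rV[R[i]]_n.+1)
    (x : 'rV[R[i]]_n.+1) :
  \sum_(i < n.+1) sqnorm2 (x *m proj_ortho (gabor_space g i)) =
  #|[set k | g 0 k != 0]|%:R * sqnorm2 x.
Proof.
rewrite /sqnorm2 exchange_big mulr_sumr; apply: eq_bigr => m _.
(* For fixed m, the reflection i |-> m - i turns the count of the translates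
   of the support that contain m into the size of the support. *)
rewrite (reindex_inj (can_inj (subKr m))) /=.
rewrite -sum1_card natr_sum mulr_suml [RHS]big_mkcond /=.
apply: eq_bigr => k _; rewrite proj_ortho_gabor_space mxE subKr inE.
by case: ifP => _; rewrite ?mul1r // normr0 expr0n.
Qed.

Theorem theorem3p4 (R : realType) (n : nat) (D : {set 'I_n.+1})
    (K lambda : nat) (hD : difference_set D K lambda) :
  let v : 'rV[R[i]]_n.+1 := (1 / Num.sqrt (K%:R : R))%:C *: char_vec R D in
  tight_fusion_frame (fun i : 'I_n.+1 => gabor_space v i) (K%:R : R).
Proof.
case: hD => D0 cardD _ v.
have K_gt0 : 0 < K%:R :> R by rewrite ltr0n -cardD card_gt0.
split=> // x; rewrite sum_sqnorm2_gabor_space rmorph_nat.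
suff -> : [set k | v 0 k != 0] = D by rewrite cardD.
have c_neq0 : (1 / Num.sqrt (K%:R : R))%:C != 0.
  by rewrite fmorph_eq0 div1r invr_eq0 gt_eqF // sqrtr_gt0.
apply/setP => k; rewrite inE !mxE mulf_eq0 (negPf c_neq0) /=.
by case: ifP => _; rewrite ?oner_eq0 ?eqxx.
Qed.
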